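(* Let $\Sigma$ be a finite signature and $\mathcal{T}$ any $\Sigma$-theory. If $L_1$ and $L_2$ are $\mathcal{T}$-regular $\mathcal{T}$-languages, then $L_1\cap L_2$ and $L_1\cup L_2$ are $\mathcal{T}$-regular.
   Context: Signatures are multi-sorted first-order signatures in which every symbol is marked either rigid or non-rigid. For a signature $\Sigma$, $\Sigma'$ denotes the signature obtained from $\Sigma$ by replacing each non-rigid symbol $s$ by a fresh primed copy $s'$ (rigid symbols are kept); for a $\Sigma$-structure $\sigma$, $\sigma'$ denotes the corresponding renamed $\Sigma'$-structure. For structures over pairwise disjoint signatures with the same sort domains, $\rho\cup\sigma\cup\tau'$ denotes the combined structure over the union of the signatures. A $\Sigma$-theory $\mathcal{T}$ is a set of $\Sigma$-sentences; $[\![\mathcal{T}]\!]$ is the set of all $\Sigma$-structures with finite or countably infinite domains that satisfy $\mathcal{T}$. A $\mathcal{T}$-word is a finite sequence $\bar\sigma=\langle\sigma_0,\ldots,\sigma_{n-1}\rangle$ ($n\ge 0$) of elements of $[\![\mathcal{T}]\!]$ such that for every sort $S$ and every rigid symbol $s$ of $\Sigma$, $S^{\sigma_i}=S^{\sigma_j}$ and $s^{\sigma_i}=s^{\sigma_j}$ for all $i,j$. $[\![\mathcal{T}]\!]^*$ is the set of all $\mathcal{T}$-words; a $\mathcal{T}$-language is a subset of $[\![\mathcal{T}]\!]^*$. A first-order automaton is a tuple $\mathcal{A}=\langle\Sigma,\Gamma,\phi_0,\phi_T,\phi_F\rangle$ where $\Sigma$ (word signature) and $\Gamma$ (state signature)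 are finite disjoint signatures, $\phi_0$ and $\phi_F$ are first-order $\Gamma$-sentences, and $\phi_T$ is a first-order $(\Gamma\cup\Sigma\cup\Gamma')$-sentence. Given a $\mathcal{T}$-word $\bar\sigma=\langle\sigma_0,\ldots,\sigma_{n-1}\rangle$, a $\mathcal{T}$-run of $\mathcal{A}$ induced by $\bar\sigma$ is a sequence $\langle\rho_0,\ldots,\rho_n\rangle$ of $\Gamma$-structures such that $S^{\rho_i}=S^{\sigma_0}$ for every sort $S$ and every $i$, rigid symbols of $\Gamma$ are interpreted identically in all $\rho_i$, $\rho_0\models\phi_0$, and $\rho_i\cup\sigma_i\cup\rho'_{i+1}\models\phi_T$ for all $0\le i<n$. $\mathcal{A}$ $\mathcal{T}$-accepts $\bar\sigma$ iff some such run satisfies $\rho_n\models\phi_F$. $\mathcal{L}_{\mathcal{T}}(\mathcal{A})$ is the set of $\mathcal{T}$-words $\mathcal{T}$-accepted by $\mathcal{A}$. A $\mathcal{T}$-language $L$ is $\mathcal{T}$-regular iff $L=\mathcal{L}_{\mathcal{T}}(\mathcal{A})$ for some first-order automaton $\mathcal{A}$ with word signature $\Sigma$. *)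

(* Defs.v *)
From HB Require Import structures.
From mathcomp Require Import all_boot.
From mathcomp Require Import boolp classical_sets cardinality.

Set Implicit Arguments.
Unset Strict Implicit.
Unset Printing Implicit Defensive.

Local Open Scope classical_set_scope.

(* A finite signature over a finite set of sorts. Constants are function
   symbols with no argument sorts, propositions are predicate symbols with no
   argument sorts. *)
Record signature (srt : finType) := Signature {
  fsym : finType;
  fdom : fsym -> seq srt;
  fcod : fsym -> srt;
  frigid : pred fsym;
  psym : finType;
  pdom : psym -> seq srt;
  prigid : pred psym }.

(* Symbols are typed, not named, so the union of disjoint signatures over the
   same sorts is the sum of the symbol types. *)
Definition sigU (srt : finType) (G H : signature srt) : signature srt :=
  @Signature srt
    (fsym G + fsym H)%type
    (fun f => match f with inl g => fdom g | inr h => fdom h end)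
    (fun f => match f with inl g => fcod g | inr h => fcod h end)
    (fun f => match f with inl g => frigid g | inr h => frigid h end)
    (psym G + psym H)%type
    (fun p => match p with inl g => pdom g | inr h => pdom h end)
    (fun p => match p with inl g => prigid g | inr h => prigid h end).

Definition nonrigid (srt : finType) (G : signature srt) : signature srt :=
  @Signature srt
    {f : fsym G | ~~ frigid f} (fun f => fdom (val f)) (fun f => fcod (val f))
    (fun f => frigid (val f))
    {p : psym G | ~~ prigid p} (fun p => pdom (val p))
    (fun p => prigid (val p)).

(* The signature G u H u G'. As G' keeps the rigid symbols of G, it only adds
   the fresh copies of the non-rigid symbols of G. *)
Definition sig_step (srt : finType) (G H : signature srt) : signature srt :=
  sigU (sigU G H) (nonrigid G).

Fixpoint args (srt : Type) (D : srt -> Type) (ss : seq srt) : Type :=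
  if ss is s :: ss' then (D s * args D ss')%type else unit.

(* Well-scoped, well-sorted de Bruijn syntax: c lists the sorts of the
   variables in scope, the most recently bound one first. *)
Inductive var (srt : Type) : seq srt -> srt -> Type :=
| VarO c s : var (s :: c) s
| VarS c s t : var c s -> var (t :: c) s.

Inductive term (srt : finType) (G : signature srt) (c : seq srt) :
    srt -> Type :=
| Var s : var c s -> term G c s
| App (f : fsym G) : terms G c (fdom f) -> term G c (fcod f)
with terms (srt : finType) (G : signature srt) (c : seq srt) :
    seq srt -> Type :=
| Tnil : terms G c [::]
| Tcons s ss : term G c s -> terms G c ss -> terms G c (s :: ss).

Inductive formula (srt : finType) (G : signature srt) : seq srt -> Type :=
| Fbot c : formula G c
| Feq c s : term G c s -> term G c s -> formula G c
| Fpred c (p : psym G) : terms G c (pdom p) -> formula G c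
| Fimp c : formula G c -> formula G c -> formula G c
| Fand c : formula G c -> formula G c -> formula G c
| For c : formula G c -> formula G c -> formula G c
| Fall c s : formula G (s :: c) -> formula G c
| Fex c s : formula G (s :: c) -> formula G c.

Definition sentence (srt : finType) (G : signature srt) : Type :=
  formula G [::].

Definition theory (srt : finType) (G : signature srt) : Type :=
  set (sentence G).

Record domain (srt : finType) := Domain {
  carrier :> srt -> Type;
  carrier_inhabited : forall s, inhabited (carrier s) }.

Record interp (srt : finType) (G : signature srt) (D : domain srt) := Interp {
  fint : forall f : fsym G, args D (fdom f) -> D (fcod f);
  pint : forall p : psym G, args D (pdom p) -> Prop }.

Record structure (srt : finType) (G : signature srt) := Structure {
  dom : domain srt;
  int : interp G dom }.

Definition intU (srt : finType) (G H : signature srt) (D : domain srt)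
    (I : interp G D) (J : interp H D) : interp (sigU G H) D :=
  @Interp srt (sigU G H) D
    (fun f => match f with inl g => fint I (f := g) | inr h => fint J (f := h) end)
    (fun p => match p with inl g => pint I (p := g) | inr h => pint J (p := h) end).

Definition int_nonrigid (srt : finType) (G : signature srt) (D : domain srt)
    (I : interp G D) : interp (nonrigid G) D :=
  @Interp srt (nonrigid G) D
    (fun f => fint I (f := val f)) (fun p => pint I (p := val p)).

(* The structure I u J u K', for I and K agreeing on the rigid symbols. *)
Definition int_step (srt : finType) (G H : signature srt) (D : domain srt)
    (I : interp G D) (J : interp H D) (K : interp G D) :
    interp (sig_step G H) D :=
  intU (intU I J) (int_nonrigid K).

Definition rigid_eq (srt : finType) (G : signature srt) (D : domain srt)
    (I J : interp G D) : Prop :=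
  (forall f : fsym G, frigid f -> fint I (f := f) = fint J (f := f)) /\
  (forall p : psym G, prigid p -> pint I (p := p) = pint J (p := p)).

Fixpoint lookup (srt : Type) (D : srt -> Type) (c : seq srt) (s : srt)
    (v : var c s) : args D c -> D s :=
  match v in var c s return args D c -> D s with
  | VarO _ _ => fun e => e.1
  | VarS _ _ _ v' => fun e => lookup v' e.2
  end.

Fixpoint eval (srt : finType) (G : signature srt) (D : domain srt)
    (I : interp G D) (c : seq srt) (e : args D c) (s : srt)
    (t : term G c s) : D s :=
  match t in term _ _ s return D s with
  | Var _ v => lookup v e
  | App f ts => fint I (evals I e ts)
  end
with evals (srt : finType) (G : signature srt) (D : domain srt)
    (I : interp G D) (c : seq srt) (e : args D c) (ss : seq srt)
    (ts : terms G c ss) : args D ss :=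
  match ts in terms _ _ ss return args D ss with
  | Tnil => tt
  | Tcons _ _ t ts' => (eval I e t, evals I e ts')
  end.

Fixpoint sat (srt : finType) (G : signature srt) (D : domain srt)
    (I : interp G D) (c : seq srt) (phi : formula G c) : args D c -> Prop :=
  match phi in formula _ c return args D c -> Prop with
  | Fbot _ => fun _ => False
  | Feq _ _ t u => fun e => eval I e t = eval I e u
  | Fpred _ _ ts => fun e => pint I (evals I e ts)
  | Fimp _ a b => fun e => sat I a e -> sat I b e
  | Fand _ a b => fun e => sat I a e /\ sat I b e
  | For _ a b => fun e => sat I a e \/ sat I b e
  | Fall _ s a => fun e => forall x : D s, sat I a (x, e)
  | Fex _ s a => fun e => exists x : D s, sat I a (x, e)
  end.

Definition models (srt : finType) (G : signature srt) (D : domain srt)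
    (I : interp G D) (phi : sentence G) : Prop := sat I phi tt.

Definition theory_models (srt : finType) (G : signature srt) (T : theory G) :
    set (structure G) :=
  [set M | (forall s, countable [set: dom M s]) /\
           (forall phi, T phi -> models (int M) phi)].

(* Words are sequences of structures, each carrying its own domain; the witness
   D says that the domains coincide. In particular there is a single empty
   word. *)
Definition words (srt : finType) (G : signature srt) (T : theory G) :
    set (seq (structure G)) :=
  [set w | exists (n : nat) (D : domain srt) (s : n.-tuple (interp G D)),
     [/\ w = [seq Structure J | J <- s],
         forall i, theory_models T (Structure (tnth s i)) &
         forall i j, rigid_eq (tnth s i) (tnth s j)]].

Definition is_language (srt : finType) (G : signature srt) (T : theory G)
    (L : set (seq (structure G))) : Prop := L `<=` words T.

Record automaton (srt : finType) (Sigma : signature srt) := Automaton {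
  state_sig : signature srt;
  init : sentence state_sig;
  trans : sentence (sig_step state_sig Sigma);
  final : sentence state_sig }.

Definition is_run (srt : finType) (Sigma : signature srt)
    (A : automaton Sigma) (n : nat) (D : domain srt)
    (s : n.-tuple (interp Sigma D))
    (r : n.+1.-tuple (interp (state_sig A) D)) : Prop :=
  [/\ forall i j, rigid_eq (tnth r i) (tnth r j),
      models (tnth r ord0) (init A) &
      forall i : 'I_n,
        models (int_step (tnth r (widen_ord (leqnSn n) i)) (tnth s i)
                         (tnth r (lift ord0 i)))
               (trans A)].

(* For the empty word there is no first letter to fix the domain of the run, so
   D is arbitrary; otherwise D is the common domain of the letters. *)
Definition accepts (srt : finType) (Sigma : signature srt)
    (A : automaton Sigma) (w : seq (structure Sigma)) : Prop :=
  exists (n : nat) (D : domain srt) (s : n.-tuple (interp Sigma D))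
         (r : n.+1.-tuple (interp (state_sig A) D)),
    [/\ w = [seq Structure J | J <- s],
        is_run s r &
        models (tnth r ord_max) (final A)].

Definition language (srt : finType) (Sigma : signature srt)
    (T : theory Sigma) (A : automaton Sigma) : set (seq (structure Sigma)) :=
  [set w | words T w /\ accepts A w].

Definition regular (srt : finType) (Sigma : signature srt)
    (T : theory Sigma) (L : set (seq (structure Sigma))) : Prop :=
  exists A : automaton Sigma, L = language T A.

(* Main.v *)
From mathcomp Require Import all_boot.
From mathcomp Require Import boolp classical_sets cardinality.
Require Import Defs.

(** Intersection is recognised by the product automaton, and union by the
    product automaton with an additional rigid proposition that selects the
    component which has to run. The product needs both runs over one domain:
    the letters of a nonempty word provide it, but the empty word may be
    accepted by the two automata over incompatible domains only, so that it is
    restored, when necessary, by a union with the regular language containing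
    just the empty word. *)

Set Implicit Arguments.
Unset Strict Implicit.
Unset Printing Implicit Defensive.

Local Open Scope classical_set_scope.

(** * Signature morphisms, translation of sentences, and reducts *)

Record sig_hom (srt : finType) (G H : signature srt) := SigHom {
  hom_f : fsym G -> fsym H;
  hom_p : psym G -> psym H;
  hom_fdom : forall f, fdom (hom_f f) = fdom f;
  hom_fcod : forall f, fcod (hom_f f) = fcod f;
  hom_frigid : forall f, frigid (hom_f f) = frigid f;
  hom_pdom : forall p, pdom (hom_p p) = pdom p;
  hom_prigid : forall p, prigid (hom_p p) = prigid p }.

Section Translation.
Variables (srt : finType) (G H : signature srt) (h : sig_hom G H).

(** A morphism preserves sorts and arities only up to propositional equality, hence the transports
    around applications. *)
Fixpoint tr_term c s (t : term G c s) : term H c s :=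
  match t in term _ _ s return term H c s with
  | Var _ v => Var H v
  | App f ts =>
      ecast s (term H c s) (hom_fcod h f)
        (App (ecast ss (terms H c ss) (esym (hom_fdom h f)) (tr_terms ts)))
  end
with tr_terms c ss (ts : terms G c ss) : terms H c ss :=
  match ts in terms _ _ ss return terms H c ss with
  | Tnil => Tnil H c
  | Tcons _ _ t ts' => Tcons (tr_term t) (tr_terms ts')
  end.

Fixpoint tr c (phi : formula G c) : formula H c :=
  match phi in formula _ c return formula H c with
  | Fbot c => Fbot H c
  | Feq _ _ t u => Feq (tr_term t) (tr_term u)
  | Fpred c p ts =>
      Fpred (ecast ss (terms H c ss) (esym (hom_pdom h p)) (tr_terms ts))
  | Fimp _ a b => Fimp (tr a) (tr b)
  | Fand _ a b => Fand (tr a) (tr b)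
  | For _ a b => For (tr a) (tr b)
  | Fall _ _ a => Fall (tr a)
  | Fex _ _ a => Fex (tr a)
  end.

Definition reduct (D : domain srt) (I : interp H D) : interp G D :=
  @Interp srt G D
    (fun f a => ecast s (D s) (hom_fcod h f)
       (fint I (ecast ss (args D ss) (esym (hom_fdom h f)) a)))
    (fun p a => pint I (ecast ss (args D ss) (esym (hom_pdom h p)) a)).

Variables (D : domain srt) (I : interp H D).

Lemma eval_cast c (e : args D c) s s' (E : s = s') (t : term H c s) :
  eval I e (ecast s (term H c s) E t) = ecast s (D s) E (eval I e t).
Proof. by case: _ / E. Qed.

Lemma evals_cast c (e : args D c) ss ss' (E : ss = ss') (ts : terms H c ss) :
  evals I e (ecast ss (terms H c ss) E ts) =
  ecast ss (args D ss) E (evals I e ts).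
Proof. by case: _ / E. Qed.

Fixpoint eval_tr c (e : args D c) s (t : term G c s) :
  eval I e (tr_term t) = eval (reduct I) e t
with evals_tr c (e : args D c) ss (ts : terms G c ss) :
  evals I e (tr_terms ts) = evals (reduct I) e ts.
Proof.
- case: t => [s' v|f ts] //=.
  by rewrite eval_cast /= evals_cast evals_tr.
- case: ts => [|s' ss' t ts] //=.
  by rewrite eval_tr evals_tr.
Qed.

(** This is the satisfaction condition for [h]. A reduct keeps the domain, so quantifiers range over
    the same elements and only the atoms depend on the morphism. *)
Lemma sat_tr c (phi : formula G c) (e : args D c) :
  sat I (tr phi) e <-> sat (reduct I) phi e.
Proof.
elim: phi e => {c} [c|c s t u|c p ts|c a IHa b IHb|c a IHa b IHb|c a IHa b IHb
                  |c s a IHa|c s a IHa] e //=.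
- by rewrite !eval_tr.
- by rewrite evals_cast evals_tr.
- by rewrite IHa IHb.
- by rewrite IHa IHb.
- by rewrite IHa IHb.
- by split=> Ha x; apply/IHa.
- by split=> -[x /IHa Ha]; exists x.
Qed.

Lemma models_tr (phi : sentence G) :
  models I (tr phi) <-> models (reduct I) phi.
Proof. exact: sat_tr. Qed.

Lemma rigid_eq_reduct (J : interp H D) :
  rigid_eq I J -> rigid_eq (reduct I) (reduct J).
Proof.
move=> [IJf IJp]; split=> [f rf|p rp] /=.
  by rewrite IJf ?hom_frigid.
by rewrite IJp ?hom_prigid.
Qed.

End Translation.

(** * Inclusions into unions, and their extension to transition signatures *)

Definition hom_inl (srt : finType) (G H : signature srt) :
    sig_hom G (sigU G H) :=
  @SigHom srt G (sigU G H) inl inl (fun=> erefl) (fun=> erefl) (fun=> erefl)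
    (fun=> erefl) (fun=> erefl).

Definition hom_inr (srt : finType) (G H : signature srt) :
    sig_hom H (sigU G H) :=
  @SigHom srt H (sigU G H) inr inr (fun=> erefl) (fun=> erefl) (fun=> erefl)
    (fun=> erefl) (fun=> erefl).

Definition hom_unprimed (srt : finType) (G S : signature srt) :
    sig_hom G (sig_step G S) :=
  @SigHom srt G (sig_step G S) (inl \o inl) (inl \o inl)
    (fun=> erefl) (fun=> erefl) (fun=> erefl) (fun=> erefl) (fun=> erefl).

Section StepHom.
Variables (srt : finType) (G H S : signature srt) (h : sig_hom G H).

(** Only non-rigid symbols have primed copies, so [h] extends to these copies because it preserves
    non-rigidity. *)
Lemma hom_f_nonrigid (f : fsym G) : ~~ frigid f -> ~~ frigid (hom_f h f).
Proof. by rewrite hom_frigid. Qed.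

Lemma hom_p_nonrigid (p : psym G) : ~~ prigid p -> ~~ prigid (hom_p h p).
Proof. by rewrite hom_prigid. Qed.

Definition step_f (f : fsym (sig_step G S)) : fsym (sig_step H S) :=
  match f with
  | inl (inl g) => inl (inl (hom_f h g))
  | inl (inr s) => inl (inr s)
  | inr g => inr (exist _ (hom_f h (val g)) (hom_f_nonrigid (valP g)))
  end.

Definition step_p (p : psym (sig_step G S)) : psym (sig_step H S) :=
  match p with
  | inl (inl g) => inl (inl (hom_p h g))
  | inl (inr s) => inl (inr s)
  | inr g => inr (exist _ (hom_p h (val g)) (hom_p_nonrigid (valP g)))
  end.

(* The equations compute, so that the casts in [reduct step_hom] reduce to
   those in [reduct h]. *)
Definition step_hom : sig_hom (sig_step G S) (sig_step H S) :=
  @SigHom srt (sig_step G S) (sig_step H S) step_f step_p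
    (fun f => match f return fdom (step_f f) = @fdom srt (sig_step G S) f with
              | inl (inl g) => hom_fdom h g
              | inl (inr _) => erefl
              | inr g => hom_fdom h (val g)
              end)
    (fun f => match f return fcod (step_f f) = @fcod srt (sig_step G S) f with
              | inl (inl g) => hom_fcod h g
              | inl (inr _) => erefl
              | inr g => hom_fcod h (val g)
              end)
    (fun f => match f return frigid (step_f f) = @frigid srt (sig_step G S) f with
              | inl (inl g) => hom_frigid h g
              | inl (inr _) => erefl
              | inr g => hom_frigid h (val g)
              end)
    (fun p => match p return pdom (step_p p) = @pdom srt (sig_step G S) p with
              | inl (inl g) => hom_pdom h g
              | inl (inr _) => erefl
              | inr g => hom_pdom h (val g)
              end)
    (fun p => match p return prigid (step_p p) = @prigid srt (sig_step G S) p with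
              | inl (inl g) => hom_prigid h g
              | inl (inr _) => erefl
              | inr g => hom_prigid h (val g)
              end).

Lemma reduct_step (D : domain srt) (I K : interp H D) (J : interp S D) :
  reduct step_hom (int_step I J K) = int_step (reduct h I) J (reduct h K).
Proof.
by congr Interp; [apply: functional_extensionality_dep => -[[f|f]|f]
                 |apply: functional_extensionality_dep => -[[p|p]|p]].
Qed.

Lemma models_tr_step (D : domain srt) (I K : interp H D) (J : interp S D)
    (phi : sentence (sig_step G S)) :
  models (int_step I J K) (tr step_hom phi) <->
  models (int_step (reduct h I) J (reduct h K)) phi.
Proof. by rewrite -reduct_step; apply: models_tr. Qed.

End StepHom.

Section Reducts.
Variables (srt : finType) (G H : signature srt) (D : domain srt).

Lemma reduct_inl (I : interp G D) (J : interp H D) :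
  reduct (hom_inl G H) (intU I J) = I.
Proof. by case: I. Qed.

Lemma reduct_inr (I : interp G D) (J : interp H D) :
  reduct (hom_inr G H) (intU I J) = J.
Proof. by case: J. Qed.

Lemma reduct_unprimed (I K : interp G D) (J : interp H D) :
  reduct (hom_unprimed G H) (int_step I J K) = I.
Proof. by case: I. Qed.

Lemma rigid_eqU (I I' : interp G D) (J J' : interp H D) :
  rigid_eq I I' -> rigid_eq J J' -> rigid_eq (intU I J) (intU I' J').
Proof.
move=> [If Ip] [Jf Jp].
by split=> -[x|x] /=; [exact: If|exact: Jf|exact: Ip|exact: Jp].
Qed.

(** Carriers are nonempty, so constant functions interpret all function symbols. This supplies
    states for an automaton that does not have to run. *)
Lemma interp_inhabited : inhabited (interp G D).
Proof.
have d s : D s.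
  by apply: (sval (cid (_ : exists x : D s, True)));
     have [x] := carrier_inhabited D s; exists x.
exact: inhabits (@Interp srt G D (fun f _ => d (fcod f)) (fun _ _ => True)).
Qed.

End Reducts.

(** * Words and the domain of a run *)

Section Words.
Variables (srt : finType) (S : signature srt).

(** A structure is a dependent pair, so equal structures have equal interpretations only up to
    transport along an equality of domains; by proof irrelevance that equality is reflexivity. *)
Lemma Structure_inj (D : domain srt) :
  injective (fun J : interp S D => Structure J).
Proof.
have cast_int (M N : structure S) (E : M = N) :
  ecast D (interp S D) (congr1 (@dom srt S) E) (int M) = int N by case: _ / E.
move=> J K E; have := cast_int _ _ E => /=.
by rewrite (Prop_irrelevance (congr1 (@dom srt S) E) erefl).
Qed.

Lemma words_nil (T : theory S) : words T [::].
Proof.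
exists 0, (Domain (fun=> inhabits tt)), [tuple].
by split=> // -[].
Qed.

(** Acceptance provides a run over some domain of its own. The first letter forces this domain to be
    [D], which lets two accepting runs on the same word be combined. *)
Lemma accepts_cons (A : automaton S) (D : domain srt) (n : nat)
    (s : n.+1.-tuple (interp S D)) :
  accepts A [seq Structure J | J <- s] ->
  exists2 r : n.+2.-tuple (interp (state_sig A) D),
    is_run s r & models (tnth r ord_max) (final A).
Proof.
move=> [n' [D' [s' [r [E run_r fin_r]]]]].
have En : n' = n.+1.
  by have /(congr1 size) := E; rewrite !size_map !size_tuple.
subst n'.
have ED : D' = D.
  case/tupleP: s' E {run_r} => J' s'; case/tupleP: s => J s /=.
  (* Both words are nonempty, so the default value [D] is never taken. *)
  by move=> /(congr1 (fun w => if w is M :: _ then dom M else D)).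
subst D'.
have Es : s = s' by apply/val_inj/(inj_map (@Structure_inj D)).
by subst s'; exists r.
Qed.

End Words.

(** * The language of the empty word *)

Section NilAutomaton.
Variables (srt : finType) (S : signature srt) (T : theory S).

Definition empty_sig : signature srt :=
  @Signature srt void (fun=> [::]) (fun f => match f with end) (fun=> false)
    void (fun=> [::]) (fun=> false).

(** [Fimp (Fbot _ _) (Fbot _ _)] serves as truth; the unsatisfiable transition sentence prevents the
    reading of any letter. *)
Definition nil_automaton : automaton S :=
  @Automaton srt S empty_sig (Fimp (Fbot _ _) (Fbot _ _)) (Fbot _ _)
    (Fimp (Fbot _ _) (Fbot _ _)).

Lemma regular_nil : regular T [set [::]].
Proof.
exists nil_automaton; apply/seteqP; split=> [w ->|w [_]].
  split; first exact: words_nil.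
  pose D : domain srt := Domain (fun=> inhabits tt).
  have [I] := interp_inhabited empty_sig D.
  exists 0, D, [tuple], [tuple I]; split=> //.
  by split=> [i j||[]] //; rewrite !ord1.
case=> -[|n] [D [s [r [-> [_ _ tr_r] _]]]]; first by rewrite tuple0.
by have := tr_r ord0.
Qed.

End NilAutomaton.

(** * The product automaton *)

Section Product.
Variables (srt : finType) (S : signature srt) (A1 A2 : automaton S).
Let G1 := state_sig A1.
Let G2 := state_sig A2.

Definition product : automaton S :=
  @Automaton srt S (sigU G1 G2)
    (Fand (tr (hom_inl G1 G2) (init A1)) (tr (hom_inr G1 G2) (init A2)))
    (Fand (tr (step_hom S (hom_inl G1 G2)) (trans A1))
          (tr (step_hom S (hom_inr G1 G2)) (trans A2)))
    (Fand (tr (hom_inl G1 G2) (final A1)) (tr (hom_inr G1 G2) (final A2))).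

(** Both component runs are reducts of the given run over its own domain, so this covers the empty
    word too. *)
Lemma accepts_product w : accepts product w -> accepts A1 w /\ accepts A2 w.
Proof.
move=> [n [D [s [r [-> [rig_r [in1 in2] tr_r] [fin1 fin2]]]]]].
split; exists n, D, s.
- exists (map_tuple (@reduct _ _ _ (hom_inl G1 G2) D) r); split=> //; last first.
    by rewrite tnth_map; apply/models_tr.
  split=> [i j||i]; rewrite !tnth_map.
  + exact: rigid_eq_reduct.
  + exact/models_tr.
  + by have [tr1 _] := tr_r i; apply/models_tr_step.
- exists (map_tuple (@reduct _ _ _ (hom_inr G1 G2) D) r); split=> //; last first.
    by rewrite tnth_map; apply/models_tr.
  split=> [i j||i]; rewrite !tnth_map.
  + exact: rigid_eq_reduct.
  + exact/models_tr.
  + by have [_ tr2] := tr_r i; apply/models_tr_step.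
Qed.

Lemma product_accepts w :
  w <> [::] -> accepts A1 w -> accepts A2 w -> accepts product w.
Proof.
move=> w0 [[|n] [D [s [r1 [Ew [rig1 in1 tr1] fin1]]]]].
  by case: w0; rewrite Ew tuple0.
(* The word is nonempty, so the second run can be taken over the domain [D] of the first. *)
rewrite Ew => /accepts_cons[r2 [rig2 in2 tr2] fin2].
exists n.+1, D, s, [tuple intU (tnth r1 i) (tnth r2 i) | i < n.+2].
split=> //.
  split=> [i j||i]; rewrite !tnth_mktuple.
  - exact: rigid_eqU.
  - by split; apply/models_tr; rewrite ?reduct_inl ?reduct_inr.
  - by split; apply/models_tr_step; rewrite ?reduct_inl ?reduct_inr.
rewrite tnth_mktuple.
by split; apply/models_tr; rewrite ?reduct_inl ?reduct_inr.
Qed.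

End Product.

(** * The choice automaton for unions *)

Definition flag_sig (srt : finType) : signature srt :=
  @Signature srt void (fun=> [::]) (fun f => match f with end) (fun=> true)
    unit (fun=> [::]) (fun=> true).

Definition flag_interp (srt : finType) (D : domain srt) (b : Prop) :
    interp (flag_sig srt) D :=
  @Interp srt (flag_sig srt) D (fun f => match f with end) (fun _ _ => b).

Definition flag_sentence (srt : finType) : sentence (flag_sig srt) :=
  @Fpred srt (flag_sig srt) [::] tt (Tnil (flag_sig srt) [::]).

Definition Fif (srt : finType) (G : signature srt) (c : seq srt)
    (b phi psi : formula G c) : formula G c :=
  For (Fand b phi) (Fand (Fimp b (Fbot G c)) psi).

Section Choice.
Variables (srt : finType) (S : signature srt) (A1 A2 : automaton S).
Let G1 := state_sig A1.
Let G2 := state_sig A2.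
Let P := sigU (sigU G1 G2) (flag_sig srt).
Let flag := tr (hom_inr (sigU G1 G2) (flag_sig srt)) (flag_sentence srt).
Let h : sig_hom (sigU G1 G2) P := hom_inl (sigU G1 G2) (flag_sig srt).
Let h1 := hom_inl G1 G2.
Let h2 := hom_inr G1 G2.

Definition choice_automaton : automaton S :=
  @Automaton srt S P
    (Fif flag (tr h (tr h1 (init A1))) (tr h (tr h2 (init A2))))
    (Fif (tr (hom_unprimed P S) flag)
       (tr (step_hom S h) (tr (step_hom S h1) (trans A1)))
       (tr (step_hom S h) (tr (step_hom S h2) (trans A2))))
    (Fif flag (tr h (tr h1 (final A1))) (tr h (tr h2 (final A2)))).

(** The flag is rigid and so has no primed copy: the guard of a transition is read in its source
    state. *)
Lemma models_unprimed_flag (D : domain srt) (I K : interp P D)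
    (J : interp S D) :
  models (int_step I J K) (tr (hom_unprimed P S) flag) <-> models I flag.
Proof.
(* Only the [I] on the right is expanded, which turns the goal into the satisfaction condition for
   [hom_unprimed]. *)
rewrite -{2}[I](reduct_unprimed I K J).
exact: (models_tr (hom_unprimed P S)).
Qed.

Lemma rigid_flag (D : domain srt) (I J : interp P D) :
  rigid_eq I J -> models I flag -> models J flag.
Proof. by case=> _ /(_ (inr tt) isT) E; rewrite /models /= E. Qed.

Lemma accepts_choice w :
  accepts choice_automaton w -> accepts A1 w \/ accepts A2 w.
Proof.
move=> [n [D [s [r [-> [rig_r in_r tr_r] fin_r]]]]].
(* The flag in the first state decides the component. By rigidity it has the same value in all
   states, so every guard selects the same branch. *)
have [fl|nfl] := pselect (models (tnth r ord0) flag); [left|right].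
- have flr i : models (tnth r i) flag by apply: rigid_flag fl.
  pose red I := reduct h1 (reduct h (D := D) I).
  exists n, D, s, (map_tuple red r); split=> //; last first.
    rewrite tnth_map; case: fin_r => [[_ fin1]|[[]]]; last exact: flr.
    by move: fin1 => /models_tr/models_tr.
  split=> [i j||i]; rewrite !tnth_map.
  + by do 2!apply: rigid_eq_reduct.
  + by case: in_r => [[_ in1]|[[]]] //; move: in1 => /models_tr/models_tr.
  + case: (tr_r i) => [[_ tr1]|[[]]]; last exact/models_unprimed_flag.
    by move: tr1 => /models_tr_step/models_tr_step.
- have flr i : ~ models (tnth r i) flag.
    by move=> fl; apply: nfl; apply: rigid_flag fl.
  pose red I := reduct h2 (reduct h (D := D) I).
  exists n, D, s, (map_tuple red r); split=> //; last first.
    rewrite tnth_map; case: fin_r => [[/flr]|[_ fin2]] //.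
    by move: fin2 => /models_tr/models_tr.
  split=> [i j||i]; rewrite !tnth_map.
  + by do 2!apply: rigid_eq_reduct.
  + by case: in_r => [[]|[_ in2]] //; move: in2 => /models_tr/models_tr.
  + case: (tr_r i) => [[/models_unprimed_flag/flr]|[_ tr2]] //.
    by move: tr2 => /models_tr_step/models_tr_step.
Qed.

Lemma choice_accepts_left w : accepts A1 w -> accepts choice_automaton w.
Proof.
move=> [n [D [s [r [-> [rig_r in_r tr_r] fin_r]]]]].
(* The idle component stays at one fixed interpretation, so its rigid symbols do not change along
   the run. *)
have [I2] := interp_inhabited G2 D.
pose ext I : interp P D := intU (intU I I2) (flag_interp D True).
have extK I : reduct h1 (reduct h (ext I)) = I by rewrite !reduct_inl.
exists n, D, s, (map_tuple ext r); split=> //; last first.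
  rewrite tnth_map; left; split=> //.
  by apply/models_tr/models_tr; rewrite extK.
split=> [i j||i]; rewrite !tnth_map.
- by do 2!apply: rigid_eqU => //.
- by left; split=> //; apply/models_tr/models_tr; rewrite extK.
- left; split=> //.
  by apply/models_tr_step/models_tr_step; rewrite !extK.
Qed.

Lemma choice_accepts_right w : accepts A2 w -> accepts choice_automaton w.
Proof.
move=> [n [D [s [r [-> [rig_r in_r tr_r] fin_r]]]]].
have [I1] := interp_inhabited G1 D.
pose ext I : interp P D := intU (intU I1 I) (flag_interp D False).
have extK I : reduct h2 (reduct h (ext I)) = I.
  by rewrite reduct_inl reduct_inr.
exists n, D, s, (map_tuple ext r); split=> //; last first.
  rewrite tnth_map; right; split=> //.
  by apply/models_tr/models_tr; rewrite extK.
split=> [i j||i]; rewrite !tnth_map.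
- by do 2!apply: rigid_eqU => //.
- by right; split=> //; apply/models_tr/models_tr; rewrite extK.
- right; split=> //.
  by apply/models_tr_step/models_tr_step; rewrite !extK.
Qed.

End Choice.

(** * Closure under union and intersection *)

Lemma regularU (srt : finType) (S : signature srt) (T : theory S)
    (L1 L2 : set (seq (structure S))) :
  regular T L1 -> regular T L2 -> regular T (L1 `|` L2).
Proof.
move=> [A1 ->] [A2 ->]; exists (choice_automaton A1 A2).
apply/seteqP; split=> [w [[Tw acc]|[Tw acc]]|w [Tw /accepts_choice[acc|acc]]].
- by split=> //; apply: choice_accepts_left.
- by split=> //; apply: choice_accepts_right.
- by left.
- by right.
Qed.

Lemma regularI (srt : finType) (S : signature srt) (T : theory S)
    (L1 L2 : set (seq (structure S))) :
  regular T L1 -> regular T L2 -> regular T (L1 `&` L2).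
Proof.
move=> [A1 ->] [A2 ->]; set L := _ `&` _.
have sub_product : language T (product A1 A2) `<=` L.
  by move=> w [Tw /accepts_product[acc1 acc2]].
have product_sub w : w <> [::] -> L w -> language T (product A1 A2) w.
  by move=> w0 [[Tw acc1] [_ acc2]]; split=> //; apply: product_accepts.
(* If the empty word is not in [L], then all words of [L] are nonempty and the product recognises
   exactly [L]. *)
have [Lnil|Lnil] := pselect (L [::]); last first.
  exists (product A1 A2); apply/seteqP; split=> // w Lw.
  by apply: product_sub => // w0; apply: Lnil; rewrite -w0.
(* Here the empty word is in [L], so adding it to the language of the product is sound and restores
   the only word that may be missing. *)
suff -> : L = language T (product A1 A2) `|` [set [::]].
  by apply: regularU (regular_nil T); exists (product A1 A2).
apply/seteqP; split=> [w Lw|w [/sub_product|->]] //.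
by have [->|w0] := pselect (w = [::]); [right|left; apply: product_sub].
Qed.

Theorem theorem2 (srt : finType) (Sigma : signature srt) (T : theory Sigma)
    (L1 L2 : set (seq (structure Sigma)))
    (L1_language : is_language T L1) (L2_language : is_language T L2)
    (L1_regular : regular T L1) (L2_regular : regular T L2) :
  regular T (L1 `&` L2) /\ regular T (L1 `|` L2).
Proof. by split; [apply: regularI|apply: regularU]. Qed.
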